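(* Let $G$ be a finite group and let $p$ be a prime. If $G$ is not $p$-nilpotent, then $$|\Delta_p(G)|\ge \frac{|G|}{2}.$$
   Context: Let $G$ be a finite group and $x\in G$. Denote by $G_x$ the smallest subnormal subgroup of $G$ containing $x$ (that is, the intersection of all subnormal subgroups of $G$ containing $x$). The sub-class of $x$ in $G$ is $x^{G^{*}}:=x^{G_x}=\{x^g: g\in G_x\}$, the conjugacy class of $x$ in the group $G_x$, and its size is $|x^{G^{*}}|=[G_x:C_{G_x}(x)]$. For a prime $p$, define $$\Delta_p(G)=\{x\in G: p\mid |x^{G^{*}}|\}.$$ A finite group $G$ is $p$-nilpotent if it has a normal $p$-complement, i.e. a normal subgroup $K$ of order prime to $p$ such that $G/K$ is a $p$-group. *)

(* Defs.v *)
From mathcomp Require Import all_boot all_fingroup all_solvable.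

Set Implicit Arguments.
Unset Strict Implicit.
Unset Printing Implicit Defensive.

Local Open Scope group_scope.

Section Defs.

Variable gT : finGroupType.
Implicit Types (G H K : {group gT}) (x : gT) (p : nat).

(* For x \notin G the index set is empty and this is the whole of gT; it is
   only used for x \in G. *)
Definition subnormal_closure G x : {set gT} :=
  \bigcap_(H : {group gT} | (H <|<| G) && (x \in H)) H.

Canonical subnormal_closure_group G x := [group of subnormal_closure G x].

Definition subclass G x : {set gT} := x ^: subnormal_closure G x.

Definition Delta p G : {set gT} := [set x in G | p %| #|subclass G x|].

Definition p_nilpotent p G : bool :=
  [exists K : {group gT}, [&& K <| G, p^'.-group K & p.-group (G / K)]].

Lemma mem_subnormal_closure G x : x \in subnormal_closure G x.
Proof. by apply/bigcapP=> H /andP[]. Qed.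

Lemma subnormal_closure_min G H x :
  H <|<| G -> x \in H -> subnormal_closure G x \subset H.
Proof. by move=> snHG Hx; apply: bigcap_inf; rewrite snHG. Qed.

Lemma subnormal_closureP G x : x \in G -> subnormal_closure G x <|<| G.
Proof.
move=> Gx; have [H /mingroupP[/andP[snHG Hx] minH] _] :
    {H : {group gT} | [min H | (H <|<| G) && (x \in H)] & H \subset G}.
  by apply: mingroup_exists; rewrite subnormal_refl.
suffices ->: subnormal_closure G x = H by [].
apply/eqP; rewrite eqEsubset subnormal_closure_min //=.
apply/bigcapsP=> K /andP[snKG Kx]; apply/setIidPl; apply: minH (subsetIl _ _).
rewrite inE Hx Kx !andbT /= setIC.
exact: subnormal_trans (setI_subnormal (subnormal_sub snHG) snKG) snHG.
Qed.

Lemma card_subclass G x :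
  #|subclass G x| = #|subnormal_closure G x : 'C_(subnormal_closure G x)[x]|.
Proof. by rewrite index_cent1. Qed.

End Defs.

(* Main.v *)
Require Import Defs.
From mathcomp Require Import all_boot all_order all_algebra all_fingroup all_solvable.

(** Let x lie outside [Delta p G], i.e. x centralises a Sylow p-subgroup of its
    subnormal closure S. This property passes to quotients, so by induction one
    may assume that 'O_p^'(G) = 1 and that proper quotients of G are
    p-nilpotent.
    If 'O_p(G) = 1, a minimal nontrivial subnormal subgroup T is nonabelian
    simple and not p-nilpotent. As T lies in S or centralises S, x centralises
    a Sylow p-subgroup of T, and the number of such x is at most
    |G| / |N_T(P) : C_T(P)| with P Sylow in T, hence at most |G| / 2 by
    Burnside's transfer theorem.
    If Z = 'Z('O_p(G)) <> 1, then S centralises Z :&: S, so p'-elements of S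
    centralise Z by coprime action; as G / Z is p-nilpotent and
    'O_p^'(G) = 1, they are trivial. Then S is a subnormal p-group and
    x lies in 'O_p(G), a proper subgroup. *)

(** * Subnormal subgroups, coprime action, Burnside's transfer theorem and counting *)

Section Subnormal.

Local Open Scope group_scope.
Set Implicit Arguments.
Unset Strict Implicit.

Variable gT : finGroupType.
Implicit Types (G H K M P S T : {group gT}) (A B : {set gT}) (x : gT).
Implicit Types (p : nat) (pi : nat_pred).

Lemma Sylow_setI_subnormal p G H P :
  H <|<| G -> p.-Sylow(G) P -> p.-Sylow(H) (P :&: H).
Proof.
have [n] := ubnP #|G|; elim: n => // n IHn in G P * => leGn.
move=> snHG sylP; have [-> | [K [snHK nsKG ltKG]]] := subnormalEr snHG.
  by rewrite (setIidPl (pHall_sub sylP)).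
have sylPK : p.-Sylow(K) (P :&: K)%G.
  by rewrite /= setIC; apply: Sylow_setI_normal sylP.
have := IHn _ _ (leq_trans (proper_card ltKG) leGn) snHK sylPK.
by rewrite /= -setIA (setIidPr (subnormal_sub snHK)).
Qed.

Lemma pcore_subnormal pi G H : H <|<| G -> 'O_pi(H) \subset 'O_pi(G).
Proof.
have [n] := ubnP #|G|; elim: n => // n IHn in G * => leGn snHG.
have [-> // | [K [snHK nsKG ltKG]]] := subnormalEr snHG.
apply: subset_trans (IHn _ (leq_trans (proper_card ltKG) leGn) snHK) _.
by rewrite pcore_max ?pcore_pgroup ?gFnormal_trans.
Qed.

(** A proper normal [K] above [S] contains [A], hence also [[~: B, A]]. Since commuting with [A]
    again loses nothing, [[~: B, A]] can replace [B] and [K] can replace [G], down a subnormal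
    series to [S]. *)
Lemma comm_subnormal G S A B :
    S <|<| G -> A \subset S -> B \subset G -> [~: B, A, A] = [~: B, A] ->
  [~: B, A] \subset S.
Proof.
have [n] := ubnP #|G|; elim: n => // n IHn in G B * => leGn.
move=> snSG sAS sBG defBA.
have [-> | [K [snSK nsKG ltKG]]] := subnormalEr snSG.
  by rewrite comm_subG // (subset_trans sAS) ?subnormal_sub.
have sAK := subset_trans sAS (subnormal_sub snSK).
have sBAK : [~: B, A] \subset K.
  apply: subset_trans (commgSS sBG sAK) _.
  by rewrite commg_subr normal_norm.
rewrite -defBA; apply: IHn (leq_trans (proper_card ltKG) leGn) snSK sAS sBAK _.
by rewrite defBA.
Qed.

(** Take a proper normal [N] above [S]. If [T] lies in [N], induct inside [N]. Otherwise [T] lies in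
    a proper normal [R], and induction in [R] shows that [T] centralises [N :&: R], which contains
    [[~: T, N]]. The three subgroups lemma then makes the perfect group [T] centralise [N]. *)
Lemma simple_subnormal_cent G S T :
    simple T -> ~~ abelian T -> T <|<| G -> S <|<| G ->
  T \subset S \/ T \subset 'C(S).
Proof.
move=> simT nabT; have [ntT nsT] := simpleP _ simT.
have defT : T^`(1) = T.
  by have [/derG1P|//] := nsT _ (der_normal 1 T); rewrite (negPf nabT).
have [n] := ubnP #|G|; elim: n => // n IHn in G S * => leGn.
move=> snTG snSG; have [-> | [N [snSN nsNG ltNG]]] := subnormalEr snSG.
  by left; apply: subnormal_sub.
have [sTN | not_sTN] := boolP (T \subset N).
  apply: IHn (leq_trans (proper_card ltNG) leGn) _ snSN => //.
  have := setI_subnormal (normal_sub nsNG) snTG.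
  by rewrite /= (setIidPl sTN).
right; apply: subset_trans (centS (subnormal_sub snSN)).
have [defG | [R [snTR nsRG ltRG]]] := subnormalEr snTG.
  rewrite -defG in nsNG ltNG.
  have [-> | defN] := nsT _ nsNG; first by rewrite cents1.
  by rewrite defN properxx in ltNG.
have snNR : (N :&: R)%G <|<| R.
  by rewrite normal_subnormal //= setIC (normalGI (normal_sub nsRG)).
have [sTNR | cTNR] := IHn _ _ (leq_trans (proper_card ltRG) leGn) snTR snNR.
  by case/negP: not_sTN; apply: subset_trans sTNR (subsetIl _ _).
have sTNNR : [~: T, N] \subset N :&: R.
  rewrite subsetI commg_subr.
  rewrite (subset_trans (subnormal_sub snTG) (normal_norm nsNG)) /=.
  apply: subset_trans (commgSS (subnormal_sub snTR) (normal_sub nsNG)) _.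
  by rewrite commg_subl normal_norm.
have TNT : [~: T, N, T] = 1.
  by apply/commG1P; rewrite centsC (subset_trans cTNR) ?centS.
rewrite -defT; apply/commG1P; apply: three_subgroup => //.
by rewrite (commGC N).
Qed.

Lemma p'class_Sylow p G x : prime p ->
  (exists2 P : {group gT}, p.-Sylow(G) P & x \in 'C(P))
    <-> ~~ (p %| #|x ^: G|).
Proof.
move=> p_pr; rewrite -index_cent1; split=> [[P sylP cPx] | p'ix].
  have sPC : P \subset 'C_G[x].
    by rewrite subsetI (pHall_sub sylP) sub_cent1.
  have [_ _] := and3P sylP; rewrite p'natE //; apply: contra => /dvdn_trans->//.
  exact: indexgS.
have [P sylP] := Sylow_exists p 'C_G[x].
exists P; last by have := pHall_sub sylP; rewrite subsetI sub_cent1 => /andP[].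
have [sPC pP p'iP] := and3P sylP.
rewrite pHallE (subset_trans sPC) ?subsetIl //=.
rewrite -(Lagrange (subsetIl G 'C[x])) partnM // -(card_Hall sylP).
by rewrite (@part_p'nat p #|G : _|) ?muln1 // p'natE.
Qed.

(** [A] acts trivially on [R / Q], and coprimality lifts these fixed points to fixed points in [R =
    [~: M, A]], where only 1 is fixed because [M] is abelian. *)
Lemma coprime_abel_commgid (A M : {group gT}) :
    A \subset 'N(M) -> coprime #|M| #|A| -> abelian M ->
  [~: M, A, A] = [~: M, A].
Proof.
move=> nMA coMA abM; apply/eqP; rewrite eqEsubset.
set R := [~: M, A]%G; set Q := [~: R, A]%G.
have sRM : R \subset M by rewrite commg_subl.
have sQR : Q \subset R by rewrite commg_subl commg_normr.
have nQA : A \subset 'N(Q) := commg_normr A R.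
have abR : abelian R := abelianS sRM abM.
have nQR : R \subset 'N(Q) by rewrite cents_norm // (centsS sQR).
rewrite sQR -quotient_sub1 //=.
have coRA : coprime #|R| #|A| := coprimeSg sRM coMA.
have := coprime_quotient_cent sQR nQA coRA (abelian_sol abR).
rewrite (coprime_abel_cent_TI nMA coMA abM) quotient1 => /esym/trivgP.
by apply: subset_trans; rewrite subsetI subxx quotient_cents2r.
Qed.

(** The normal complement is the kernel of the transfer from [G] to the abelian group [P]: the
    transfer is injective on [P], and its image has order dividing that of [P]. *)
Lemma p_nilpotent_Burnside p G P :
  p.-Sylow(G) P -> 'N_G(P) \subset 'C(P) -> p_nilpotent p G.
Proof.
move=> sylP cNP; have [sPG pP p'iP] := and3P sylP.
have abP : abelian P.
  by rewrite /abelian (subset_trans _ cNP) // subsetI sPG normG.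
(* Burnside's fusion argument: P and P :^ y are Sylow in 'C_G[u ^ y]. *)
have fusion u y : u \in P -> y \in G -> u ^ y \in P -> u ^ y = u.
  move=> Pu Gy Puy; have sylJ (Q : {group gT}) :
      p.-Sylow(G) Q -> u ^ y \in Q -> abelian Q -> p.-Sylow('C_G[u ^ y]) Q.
    move=> sylQ Qu abQ; apply: pHall_subl (subsetIl _ _) (sylQ).
    by rewrite subsetI (pHall_sub sylQ) sub_cent1 (subsetP abQ).
  have sylPy : p.-Sylow('C_G[u ^ y]) (P :^ y)%G.
    by apply: sylJ; rewrite ?pHallJ ?memJ_conjg ?abelianJ.
  have [c /setIP[Gc cuc] defP] := Sylow_trans sylPy (sylJ P sylP Puy abP).
  have Nyc : y * c \in 'N_G(P).
    by rewrite inE groupM //; apply/normP; rewrite conjsgM.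
  have uyc : u ^ (y * c) = u.
    by apply/conjg_fixP/commgP/commute_sym/(centP (subsetP cNP _ Nyc)).
  rewrite -{2}uyc conjgM; apply/esym/conjg_fixP/commgP/cent1P.
  by rewrite cent1C.
have abA : abelian (idm P @* P) by rewrite morphim_idm.
pose V := transfer_morphism G abA.
(* By fusion, the transfer V acts on P as raising to the power |G : P|. *)
have V_P g : g \in P -> V g = 1 -> g = 1.
  move=> Pg; have Gg := subsetP sPG g Pg.
  have trX := transversalP (rcosets_cycle_partition sPG Gg).
  rewrite /= (transfer_cycle_expansion sPG abA Gg trX).
  have Ag : g \in idm P @* P by rewrite morphim_idm.
  rewrite (eq_bigr (fun x => FiniteModule.fmod abA g *+ #|<[g]> : P :* x|)%R)
      => [|x Xx].
    rewrite GRing.sumrMnr (sum_index_rcosets_cycle sPG Gg trX).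
    rewrite -FiniteModule.fmodX // => /(congr1 val) /=.
    rewrite FiniteModule.fmodK ?groupX // => gn1.
    apply/eqP; rewrite -order_eq1 -dvdn1.
    have /eqP <- : coprime #[g] #|G : P|.
      by apply: pnat_coprime p'iP; apply: mem_p_elt pP Pg.
    by rewrite dvdn_gcd dvdnn order_dvdn; apply/eqP.
  rewrite /restrm /= -FiniteModule.fmodX //.
  congr (FiniteModule.fmod abA _); apply: fusion.
  - exact: groupX.
  - by rewrite groupV (subsetP (transversal_sub trX)).
  - by rewrite conjgE invgK mulgA -mem_rcoset mulg_exp_card_rcosets.
have ntK : P :&: 'ker V = 1.
  by apply/trivgP/subsetP=> g /setIP[Pg Kg]; rewrite inE (V_P g) ?(mker Kg).
have nsKG : 'ker V <| G := ker_normal V.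
have p'K : p^'.-group ('ker V).
  have sylKP := Sylow_setI_normal nsKG sylP.
  have [_ _] := and3P sylKP.
  by rewrite setIC ntK indexg1.
apply/existsP; exists ('ker V)%G; rewrite nsKG p'K /=.
rewrite /pgroup (card_isog (first_isog V)).
apply: (@pnat_dvd _ #|P|) => //.
have <- : #|{: FiniteModule.fmod_of abA}| = #|P|.
  by rewrite card_sub; apply: eq_card => u; rewrite inE /= morphim_idm.
by rewrite -cardsT cardSg ?subsetT.
Qed.

Lemma simple_p_nilpotent p T :
  simple T -> p_nilpotent p T -> p.-group T || p^'.-group T.
Proof.
case/simpleP=> _ nsT /existsP[K /and3P[nsKT p'K pTK]].
have [K1 | <-] := nsT K nsKT; last by rewrite p'K orbT.
by move: pTK; rewrite K1 /pgroup -(card_isog (quotient1_isog T)) => ->.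
Qed.

Lemma p_nilpotent_p'quotient p G K :
  K <| G -> p^'.-group K -> p_nilpotent p (G / K) -> p_nilpotent p G.
Proof.
move=> nsKG p'K /existsP[Lbar /and3P[nsL p'L pGL]].
case/(inv_quotientN nsKG): nsL p'L pGL => L -> sKL nsLG p'L pGL.
apply/existsP; exists L; rewrite nsLG /=; apply/andP; split.
  rewrite -(pquotient_pgroup p'K) //.
  exact: subset_trans (normal_sub nsLG) (normal_norm nsKG).
by move: pGL; rewrite /pgroup (card_isog (third_isog sKL nsKG nsLG)).
Qed.

Lemma leq_card_bigcup (I : finType) (B : {set I}) (F : I -> {set gT}) :
  #|\bigcup_(i in B) F i| <= \sum_(i in B) #|F i|.
Proof.
elim/big_rec2: _ => [|i m U _ leUm]; first by rewrite cards0.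
by rewrite (leq_trans (leq_card_setU _ _)) ?leq_add2l.
Qed.

(** The union consists of at most [#|T : 'N_T(P)|] conjugates of ['C_G(P)]. The factor 2 is a lower
    bound for [#|'N_T(P) : 'C_T(P)|], which exceeds 1 by Burnside's theorem. *)
Lemma card_cent_Sylow p G T : T \subset G -> ~~ p_nilpotent p T ->
  2 * #|\bigcup_(P in 'Syl_p(T)) 'C_G(P)| <= #|G|.
Proof.
move=> sTG not_nilT; have [P sylP] := Sylow_exists p T.
set U := \bigcup_(Q in _) _.
have leU : #|U| <= #|T : 'N_T(P)| * #|'C_G(P)|.
  rewrite -(card_Syl sylP) -sum_nat_const.
  apply: leq_trans (leq_card_bigcup _ _) _.
  rewrite (eq_bigr (fun=> #|'C_G(P)|)) // => Q.
  rewrite inE => sylQ; have [t Tt ->] := Sylow_trans sylP sylQ.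
  by rewrite centJ -{1}(conjGid (subsetP sTG t Tt)) -conjIg cardJg.
have ltCN : 2 * #|'C_T(P)| <= #|'N_T(P)|.
  have sCN : 'C_T(P) \subset 'N_T(P) by rewrite setIS ?cent_sub.
  rewrite -(Lagrange sCN) mulnC leq_pmul2l ?cardG_gt0 // indexg_gt1.
  apply: contra not_nilT => /subset_trans sNC.
  by rewrite (p_nilpotent_Burnside sylP) ?sNC ?subsetIr.
(* The product set of ['C_G(P)] and [T] lies in [G], and their intersection is ['C_T(P)]. *)
have leCT : #|'C_G(P)| * #|T| <= #|'C_T(P)| * #|G|.
  rewrite mul_cardG mulnC leq_mul ?subset_leq_card //.
    by rewrite setIC setIA setSI ?subsetIl.
  by rewrite mul_subG ?subsetIl.
rewrite -(leq_pmul2r (cardG_gt0 T)).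
apply: (@leq_trans (2 * (#|T : 'N_T(P)| * #|'C_G(P)|) * #|T|)).
  by rewrite leq_mul2r leq_mul2l leU !orbT.
rewrite -!mulnA mulnCA.
apply: (@leq_trans (#|T : 'N_T(P)| * (#|'N_T(P)| * #|G|))).
  rewrite leq_mul2l; apply/orP; right.
  apply: leq_trans (_ : 2 * (#|'C_T(P)| * #|G|) <= _).
    by rewrite leq_mul2l leCT orbT.
  by rewrite mulnA leq_mul2r ltCN orbT.
by rewrite mulnA (mulnC #|_ : _|) Lagrange ?subsetIl // mulnC.
Qed.

End Subnormal.

(** * Elements outside [Delta]: quotients, trivial and nontrivial p-core *)

Section Delta.

Local Open Scope group_scope.
Set Implicit Arguments.
Unset Strict Implicit.

Variable gT : finGroupType.
Implicit Types (G M N P S T : {group gT}) (x : gT) (p : nat).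

Lemma notin_DeltaP p G x : prime p -> x \in G -> x \notin Delta p G ->
  exists2 P : {group gT}, p.-Sylow(subnormal_closure_group G x) P & x \in 'C(P).
Proof.
by move=> p_pr Gx; rewrite inE Gx /= => p'x; apply/p'class_Sylow.
Qed.

(** The closure [U] of [coset M x] is subnormal in [S / M], so the image of a Sylow subgroup of [S]
    centralised by [x] meets [U] in a Sylow subgroup of [U]. *)
Lemma mem_Delta_quotient p G M x : prime p -> M <| G -> x \in G ->
  coset M x \in Delta p (G / M) -> x \in Delta p G.
Proof.
move=> p_pr nsMG Gx; apply: contraLR => /(notin_DeltaP p_pr Gx)[P sylP cPx].
set S := subnormal_closure_group G x in sylP.
have snS : S <|<| G := subnormal_closureP Gx.
have nMG := normal_norm nsMG.
have nMS := subset_trans (subnormal_sub snS) nMG.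
have GMx : coset M x \in G / M by rewrite mem_quotient.
rewrite inE GMx negb_and /=; apply/p'class_Sylow => //.
have snU := subnormal_closureP GMx.
set U := subnormal_closure_group _ _ in snU *.
have sUS : U \subset S / M.
  apply: subnormal_closure_min (quotient_subnormal M snS) _.
  by rewrite mem_quotient ?mem_subnormal_closure.
have snUS : U <|<| (S / M)%G.
  have := setI_subnormal (subnormal_sub (quotient_subnormal M snS)) snU.
  by rewrite /= (setIidPl sUS).
have sylPM := quotient_pHall (subset_trans (pHall_sub sylP) nMS) sylP.
exists (P / M :&: U)%G; first exact: Sylow_setI_subnormal snUS sylPM.
apply: subsetP (centS (subsetIl _ _)) _ _.
apply: subsetP (quotient_cent M P) _ _.
by rewrite mem_quotient.
Qed.

Lemma card_Delta_quotient p G M : prime p -> M <| G ->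
  #|Delta p (G / M)| * #|M| <= #|Delta p G|.
Proof.
move=> p_pr nsMG; have nMG := normal_norm nsMG.
(* Viewed as subsets of [G], the elements of [Delta p (G / M)] are disjoint cosets of size [#|M|],
   all contained in [Delta p G]. *)
pose B : {set {set gT}} := [set set_of_coset z | z in Delta p (G / M)].
have defB z : z \in Delta p (G / M) ->
    exists x, [/\ x \in Delta p G, set_of_coset z = M :* x & z = coset M x].
  move=> Dz; have: z \in G / M by case/setIdP: Dz.
  case/morphimP=> x Nx Gx def_z; exists x; rewrite def_z val_coset //.
  by rewrite (mem_Delta_quotient p_pr nsMG Gx) -?def_z.
have sBG : B \subset rcosets M G.
  apply/subsetP=> _ /imsetP[z /defB[x [Dx -> _]] ->]; apply/rcosetsP.
  by exists x => //; case/setIdP: Dx.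
have sBD : cover B \subset Delta p G.
  apply/bigcupsP=> _ /imsetP[z Dz ->]; apply/subsetP=> y zy.
  have [x [Dx def_z _]] := defB z Dz; have [Gx _] := setIdP Dx.
  have Gy : y \in G.
    move: zy; rewrite def_z => /rcosetP[m Mm ->].
    by rewrite groupM // (subsetP (normal_sub nsMG)).
  by rewrite (mem_Delta_quotient p_pr nsMG Gy) ?(coset_mem zy).
have /and3P[_ tiM M'0] := rcosets_partition (normal_sub nsMG).
have /leqifP := leq_card_cover B; rewrite (trivIsetS sBG tiM) => /eqP cardB.
rewrite -(card_imset _ val_inj) -/B -sum_nat_const.
apply: leq_trans (subset_leq_card sBD); rewrite cardB eq_leq //.
apply: eq_bigr => _ /(subsetP sBG)/rcosetsP[x _ ->].
by rewrite card_rcoset.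
Qed.

Lemma abelian_p_nilpotent p G : abelian G -> p_nilpotent p G.
Proof.
move=> abG; have [P sylP] := Sylow_exists p G.
apply: (p_nilpotent_Burnside sylP).
by rewrite subIset // (subset_trans abG) ?centS ?(pHall_sub sylP).
Qed.

Lemma p_nilpotent_pgroup p G : 'O_p^'(G) = 1 -> p_nilpotent p G -> p.-group G.
Proof.
move=> Op'G1 /existsP[K /and3P[nsKG p'K]].
have /trivgP-> : K \subset [1 gT] by rewrite -Op'G1 pcore_max.
by rewrite /pgroup -(card_isog (quotient1_isog G)).
Qed.

(** A minimal nontrivial subnormal subgroup is simple. Were it p-nilpotent, it would be a p-group or
    a p'-group and lie in a trivial core of [G]. *)
Lemma exists_simple_subnormal p G :
    G :!=: 1 -> 'O_p(G) = 1 -> 'O_p^'(G) = 1 ->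
  exists T : {group gT}, [/\ T <|<| G, simple T & ~~ p_nilpotent p T].
Proof.
move=> ntG OpG1 Op'G1.
have [T /mingroupP[/andP[snTG ntT] minT] _] :
    {T : {group gT} | [min T | (T <|<| G) && (T :!=: 1)] & T \subset G}.
  by apply: mingroup_exists; rewrite subnormal_refl.
have simT : simple T.
  apply/simpleP; split=> // K nsKT; have [-> | ntK] := eqVneq (K : {set gT}) 1.
    by left.
  right; apply: minT (normal_sub nsKT).
  by rewrite ntK (subnormal_trans (normal_subnormal nsKT) snTG).
exists T; split=> //; apply: contra ntT => /(simple_p_nilpotent simT) pT.
rewrite -subG1; case/orP: pT => /pcore_pgroup_id <-.
  by rewrite -OpG1 pcore_subnormal.
by rewrite -Op'G1 pcore_subnormal.
Qed.

Lemma card_Delta_trivg_pcore p G : prime p ->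
    G :!=: 1 -> 'O_p(G) = 1 -> 'O_p^'(G) = 1 ->
  2 * #|G :\: Delta p G| <= #|G|.
Proof.
move=> p_pr ntG OpG1 Op'G1.
have [T [snTG simT not_nilT]] := exists_simple_subnormal ntG OpG1 Op'G1.
have nabT : ~~ abelian T := contra (@abelian_p_nilpotent p T) not_nilT.
apply: leq_trans (card_cent_Sylow (subnormal_sub snTG) not_nilT).
rewrite leq_mul2l subset_leq_card //=; apply/subsetP=> x /setDP[Gx].
case/(notin_DeltaP p_pr Gx); set S := subnormal_closure_group G x => P sylP cPx.
have snSG := subnormal_closureP Gx.
have [sTS | cTS] := simple_subnormal_cent simT nabT snTG snSG.
  have snTS : T <|<| S.
    have := setI_subnormal (subnormal_sub snSG) snTG.
    by rewrite /= (setIidPl sTS).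
  apply/bigcupP; exists (P :&: T)%G.
    by rewrite inE; apply: Sylow_setI_subnormal snTS sylP.
  by rewrite inE Gx (subsetP (centS (subsetIl P T))).
(* Here [x], being in [S], centralises all of [T], so any Sylow subgroup serves. *)
have [Q sylQ] := Sylow_exists p T.
apply/bigcupP; exists Q; first by rewrite inE.
rewrite inE Gx (subsetP (centS (pHall_sub sylQ))) //.
by move: cTS; rewrite centsC => /subsetP-> //; apply: mem_subnormal_closure.
Qed.

(** [Z] is a central Sylow p-subgroup of ['C_N(Z)], which is thus p-nilpotent by Burnside's theorem;
    its p'-core lies in that of [G]. *)
Lemma cent_Z_pcore_pgroup p G N (Z := 'Z('O_p(G))) :
    'O_p^'(G) = 1 -> N <| G -> Z \subset N -> p^'.-group (N / Z) ->
  p.-group 'C_N(Z).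
Proof.
move=> Op'G1 nsNG sZN p'NZ.
have nsZG : Z <| G by rewrite !gFnormal_trans.
have nsCG : 'C_N(Z) <| G.
  apply/andP; split; first exact: subset_trans (subsetIl _ _) (normal_sub nsNG).
  by rewrite normsI ?norms_cent ?normal_norm.
have sylZ : p.-Sylow('C_N(Z)) Z.
  rewrite /pHall subsetI sZN (center_abelian _ : Z \subset 'C(Z)) /=.
  rewrite (pgroupS (center_sub _) (pcore_pgroup p G)) -card_quotient.
    by rewrite -/(pgroup _ _) (pgroupS _ p'NZ) ?quotientS ?subsetIl.
  by rewrite subIset // (normal_norm (normalS sZN (normal_sub nsNG) nsZG)).
apply: p_nilpotent_pgroup.
  by apply/trivgP; rewrite /= -Op'G1 pcore_subnormal ?normal_subnormal.
apply: p_nilpotent_Burnside sylZ _.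
by rewrite /= (subset_trans (subsetIl _ _)) ?subsetIr.
Qed.

Lemma setD_Delta_sub_pcore p G : prime p ->
    'O_p^'(G) = 1 -> p_nilpotent p (G / 'Z('O_p(G))) ->
  G :\: Delta p G \subset 'O_p(G).
Proof.
move=> p_pr Op'G1 /existsP[Nbar /and3P[nsN p'N pGN]].
have nsZG : 'Z('O_p(G)) <| G by rewrite !gFnormal_trans.
case/(inv_quotientN nsZG): nsN p'N pGN => N -> sZN nsNG p'N.
rewrite /pgroup (card_isog (third_isog sZN nsZG nsNG)) -/(pgroup _ _) => pGN.
have pC := cent_Z_pcore_pgroup Op'G1 nsNG sZN p'N.
set Z := 'Z('O_p(G))%G in sZN nsZG pC.
have pZ : p.-group Z := pgroupS (center_sub _) (pcore_pgroup p G).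
apply/subsetP=> x /setDP[Gx].
case/(notin_DeltaP p_pr Gx); set S := subnormal_closure_group G x => P sylP cPx.
have snSG : S <|<| G := subnormal_closureP Gx.
have sSG := subnormal_sub snSG.
have nsZS : S :&: Z <| S := normalGI sSG nsZG.
(* [S :&: Z] is a normal p-subgroup of [S], so it lies in [P] and [x] centralises it. Its
   centraliser in [S] is then subnormal in [G] and contains [x], so minimality of [S] applies. *)
have cSZ : S \subset 'C(S :&: Z).
  suffices : S \subset 'C_S(S :&: Z) by rewrite subsetI => /andP[].
  apply: subnormal_closure_min.
    apply: subnormal_trans snSG; apply: normal_subnormal.
    have := subcent_normal S (S :&: Z).
    by rewrite (setIidPl (normal_norm nsZS)).
  rewrite inE mem_subnormal_closure (subsetP (centS _) _ cPx) //.
  apply: subset_trans (pcore_sub_Hall sylP).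
  by rewrite pcore_max // (pgroupS (subsetIr _ _)).
suffices pS : p.-group S.
  rewrite (subsetP (pcore_subnormal p snSG)) // pcore_pgroup_id //.
  exact: mem_subnormal_closure.
apply/pgroupP=> q q_pr /Cauchy-/(_ q_pr)[b Sb ob]; apply: contraT => p'q.
have p'b : p^'.-group <[b]> by rewrite /pgroup -/#[b] ob pnatE.
have sbS : <[b]> \subset S by rewrite cycle_subG.
have sbG := subset_trans sbS sSG.
have nZb : <[b]> \subset 'N(Z) := subset_trans sbG (normal_norm nsZG).
have coZb : coprime #|Z| #|<[b]>| := pnat_coprime pZ p'b.
have defZb := coprime_abel_commgid nZb coZb (center_abelian _).
(* Coprime action pushes [[~: Z, <[b]>]] into [S :&: Z], which [b] centralises; commuting once more
   shows that it is trivial. *)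
have sZbS : [~: Z, <[b]>] \subset S :&: Z.
  rewrite subsetI (comm_subnormal snSG sbS (normal_sub nsZG) defZb).
  by rewrite commg_subl.
have cZb : <[b]> \subset 'C(Z).
  rewrite centsC; apply/commG1P; rewrite -defZb; apply/commG1P.
  by rewrite centsC (subset_trans sbS) // (subset_trans cSZ) ?centS.
(* A p'-element has trivial image in the p-group [G / N]. So [b] lies in the p-group ['C_N(Z)],
   against its order [q]. *)
have sbN : <[b]> \subset N.
  have nNb := subset_trans sbG (normal_norm nsNG).
  rewrite -quotient_sub1 // -(setIid (_ / _)) coprime_TIg //.
  apply: (@pnat_coprime p); first exact: pgroupS (quotientS N sbG) pGN.
  exact: quotient_pgroup.
have : p.-group <[b]> by apply: pgroupS pC; rewrite subsetI sbN.
by rewrite /pgroup -/#[b] ob pnatE // (negPf p'q).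
Qed.

End Delta.

(** * Induction on the order of the group *)

Section CardDelta.

Local Open Scope group_scope.

Lemma leq_card_Delta (gT : finGroupType) (G : {group gT}) (p : nat) :
  prime p -> ~~ p_nilpotent p G -> #|G| <= 2 * #|Delta p G|.
Proof.
move=> p_pr; have [n] := ubnP #|G|; elim: n => // n IHn in gT G *.
move=> leGn not_nilG.
(* A proper quotient that is not p-nilpotent settles the claim by induction. *)
have quoG (M : {group gT}) :
    M <| G -> M :!=: 1 -> ~~ p_nilpotent p (G / M) ->
  #|G| <= 2 * #|Delta p G|.
  move=> nsMG ntM not_nilGM; have [sMG nMG] := andP nsMG.
  have := IHn _ _ (leq_trans (ltn_quotient ntM sMG) leGn) not_nilGM.
  rewrite -(leq_pmul2r (cardG_gt0 M)) /= card_quotient // (mulnC #|_ : _|).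
  rewrite Lagrange // => /leq_trans; apply.
  by rewrite -mulnA leq_mul2l card_Delta_quotient ?orbT.
have sDG : Delta p G \subset G by apply/subsetP=> x /setIdP[].
have suffD : 2 * #|G :\: Delta p G| <= #|G| -> #|G| <= 2 * #|Delta p G|.
  by rewrite cardsD (setIidPr sDG) mulnBr leq_subLR mulSn mul1n leq_add2r.
have [Op'G1 | ntOp'] := eqVneq 'O_p^'(G) 1; last first.
  apply: quoG ntOp' _; first exact: pcore_normal.
  by apply: contra not_nilG; apply: p_nilpotent_p'quotient;
    rewrite ?pcore_normal ?pcore_pgroup.
have [OpG1 | ntOp] := eqVneq 'O_p(G) 1.
  apply/suffD/card_Delta_trivg_pcore => //.
  apply: contraNneq not_nilG => G1.
  by rewrite abelian_p_nilpotent // G1 abelian1.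
have ntZ : 'Z('O_p(G)) != 1.
  by rewrite (center_nil_eq1 (pgroup_nil (pcore_pgroup p G))).
have [nilGZ | not_nilGZ] := boolP (p_nilpotent p (G / 'Z('O_p(G)))); last first.
  by apply: quoG ntZ not_nilGZ; rewrite !gFnormal_trans.
apply: suffD; have sDOp := setD_Delta_sub_pcore p_pr Op'G1 nilGZ.
(* ['O_p(G)] has index at least 2, since otherwise [G] would be a p-group, hence p-nilpotent. *)
apply: leq_trans (_ : 2 * #|'O_p(G)| <= _).
  by rewrite leq_mul2l subset_leq_card ?orbT.
rewrite -(Lagrange (pcore_sub p G)) mulnC leq_pmul2l ?cardG_gt0 // indexg_gt1.
apply: contra not_nilG => sGOp; apply/existsP; exists 1%G.
by rewrite normal1 pgroup1 quotient_pgroup // (pgroupS sGOp) ?pcore_pgroup.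
Qed.

End CardDelta.

Theorem theorem1p2 (gT : finGroupType) (G : {group gT}) (p : nat) :
  prime p -> ~~ p_nilpotent p G ->
  (#|G|%:R / 2 <= #|Delta p G|%:R :> rat)%R.
Proof.
move=> p_pr not_nilG; rewrite Num.Theory.ler_pdivrMr //.
by rewrite -GRing.natrM Num.Theory.ler_nat mulnC leq_card_Delta.
Qed.
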